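(* Let $U=\begin{bmatrix}U_1 & U_2\end{bmatrix}$ be a real matrix partitioned into two blocks of columns, and let $$A=U^{T}U=\begin{bmatrix} A_{11} & A_{12} \\ A_{21} & A_{22} \end{bmatrix}$$ be its Gram matrix, partitioned conformally, so that $A_{kl}=U_k^{T}U_l$ for $k,l\in\{1,2\}$. Assume that $A_{11}$ is invertible, and let $\varepsilon\ge 0$ be such that $$\left\| A-\begin{bmatrix} A_{11} \\ A_{21} \end{bmatrix} A_{11}^{-1}\begin{bmatrix} A_{11} & A_{12} \end{bmatrix}\right\|_2\le\varepsilon\,\| A\|_2 .$$ Then there exists a matrix $B$ such that $$\|U-U_1B^{T}\|_2\le\sqrt{\varepsilon}\,\|U\|_2 .$$
   Context: For a matrix, $\|\cdot\|_2$ denotes the usual spectral (operator) norm. *)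

(* Defs.v *)
From mathcomp Require Import all_boot all_order all_algebra.
From mathcomp Require Import classical_sets reals.
Set Implicit Arguments.
Unset Strict Implicit.
Unset Printing Implicit Defensive.
Import Order.TTheory GRing.Theory Num.Theory.
Local Open Scope classical_set_scope.
Local Open Scope ring_scope.

Definition vnorm2 (R : realType) (n : nat) (x : 'cV[R]_n) : R :=
  Num.sqrt (\sum_(i < n) x i 0 ^+ 2).

(* The closed unit ball (rather than the unit sphere) makes the set nonempty
   also when n = 0, so that an empty matrix has norm 0. *)
Definition opnorm2 (R : realType) (m n : nat) (A : 'M[R]_(m, n)) : R :=
  sup [set vnorm2 (A *m x) | x in [set x : 'cV[R]_n | vnorm2 x <= 1]].

(* [sup] returns a default value on sets that are empty or unbounded above;
   this never happens in [opnorm2]. *)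
Lemma has_sup_opnorm2 (R : realType) (m n : nat) (A : 'M[R]_(m, n)) :
  has_sup [set vnorm2 (A *m x) | x in [set x : 'cV[R]_n | vnorm2 x <= 1]].
Proof.
split.
  exists (vnorm2 (A *m 0)), 0 => //=.
  rewrite /vnorm2 big1 ?sqrtr0 ?ler01 // => i _.
  by rewrite mxE expr0n.
exists (Num.sqrt (\sum_(i < m) (\sum_(j < n) `|A i j|) ^+ 2)) => _ [x /= x1 <-].
have xj j : `|x j 0| <= 1.
  apply: le_trans x1; rewrite -sqrtr_sqr ler_sqrt.
    by rewrite (bigD1 j) //= lerDl sumr_ge0 // => k _; exact: sqr_ge0.
  by apply: sumr_ge0 => k _; exact: sqr_ge0.
rewrite /vnorm2 ler_sqrt; last by apply: sumr_ge0 => i _; exact: sqr_ge0.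
apply: ler_sum => i _; rewrite -real_normK ?num_real // lerXn2r ?nnegrE //.
  by apply: sumr_ge0.
rewrite mxE; apply: le_trans (ler_norm_sum _ _ _) _.
by apply: ler_sum => j _; rewrite normrM ler_piMr.
Qed.

(* Main.v *)
Require Import Defs.
From mathcomp Require Import all_boot all_order all_algebra.
From mathcomp Require Import classical_sets reals.
From mathcomp Require Import ring lra.
Import Order.TTheory GRing.Theory Num.Theory.
Local Open Scope ring_scope.

(** With [B^T = A11^-1 U1^T U], the residual [D = U - U1 B^T] is the projection
    of [U] onto the orthogonal complement of the range of [U1], so that
    [D^T D] is the Schur-type residual of [A]. The bound is then the C*-identity
    applied on both sides: [|D|^2 = |D^T D| <= eps |U^T U| = eps |U|^2]. *)

Lemma vnorm2_ge0 {R : realType} {n} (x : 'cV[R]_n) : 0 <= vnorm2 x.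
Proof. exact: sqrtr_ge0. Qed.

Lemma sqr_vnorm2 {R : realType} {n} (x : 'cV[R]_n) :
  vnorm2 x ^+ 2 = (x^T *m x) 0 0.
Proof.
rewrite sqr_sqrtr; last by apply: sumr_ge0 => i _; exact: sqr_ge0.
by rewrite mxE; apply: eq_bigr => i _; rewrite mxE expr2.
Qed.

Lemma vnorm2Z {R : realType} {n} (a : R) (x : 'cV[R]_n) :
  0 <= a -> vnorm2 (a *: x) = a * vnorm2 x.
Proof.
move=> a0; rewrite -{2}(ger0_norm a0) -sqrtr_sqr -sqrtrM ?sqr_ge0 // mulr_sumr.
by congr Num.sqrt; apply: eq_bigr => i _; rewrite mxE exprMn.
Qed.

Lemma vnorm2_eq0 {R : realType} {n} {x : 'cV[R]_n} : vnorm2 x = 0 -> x = 0.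
Proof.
move=> x0; apply/colP => i; rewrite mxE; apply/eqP; rewrite -sqrf_eq0.
have xx j : true -> 0 <= x j 0 ^+ 2 by move=> _; exact: sqr_ge0.
have /psumr_eq0P -> // : \sum_(j < n) x j 0 ^+ 2 = 0.
by rewrite -[LHS]sqr_sqrtr ?sumr_ge0 // -/(vnorm2 x) x0 expr0n.
Qed.

(** Cauchy-Schwarz, one-sided. With [a = |x|] and [b = |y|], the expansion of [|b x - a y|^2 >= 0]
    is [2ab (ab - x^T y) >= 0], and [ab > 0] cancels once the zero vectors are set aside. *)
Lemma dot_le_vnorm2 {R : realType} {n} (x y : 'cV[R]_n) :
  (x^T *m y) 0 0 <= vnorm2 x * vnorm2 y.
Proof.
have [/vnorm2_eq0->|x0] := eqVneq (vnorm2 x) 0.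
  by rewrite trmx0 mul0mx mxE mulr_ge0 ?vnorm2_ge0.
have [/vnorm2_eq0->|y0] := eqVneq (vnorm2 y) 0.
  by rewrite mulmx0 mxE mulr_ge0 ?vnorm2_ge0.
set a := vnorm2 x in x0 *; set b := vnorm2 y in y0 *.
have ab0 : 0 < a * b by rewrite mulr_gt0 // lt0r ?x0 ?y0 vnorm2_ge0.
have ge0 : 0 <= \sum_i (b * x i 0 - a * y i 0) ^+ 2.
  by apply: sumr_ge0 => i _; exact: sqr_ge0.
have expand : \sum_i (b * x i 0 - a * y i 0) ^+ 2 =
    b ^+ 2 * (x^T *m x) 0 0 - a * b * (x^T *m y) 0 0 *+ 2
      + a ^+ 2 * (y^T *m y) 0 0.
  rewrite !mxE !mulr_sumr -sumrMnl -sumrB -big_split /=.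
  by apply: eq_bigr => i _; rewrite !mxE; ring.
rewrite expand -!sqr_vnorm2 -/a -/b in ge0.
by rewrite -(ler_pM2l ab0); lra.
Qed.

Lemma opnorm2_le {R : realType} {m n} (A : 'M[R]_(m, n)) c :
  (forall x, vnorm2 x <= 1 -> vnorm2 (A *m x) <= c) -> opnorm2 A <= c.
Proof.
move=> le_c; apply: ge_sup; first by case: (has_sup_opnorm2 A).
by move=> _ [x /= x1 <-]; exact: le_c.
Qed.

Lemma opnorm2_ge {R : realType} {m n} (A : 'M[R]_(m, n)) x :
  vnorm2 x <= 1 -> vnorm2 (A *m x) <= opnorm2 A.
Proof.
by move=> x1; apply: (sup_upper_bound (has_sup_opnorm2 A)); exists x.
Qed.

Lemma opnorm2_ge0 {R : realType} {m n} (A : 'M[R]_(m, n)) : 0 <= opnorm2 A.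
Proof.
apply: le_trans (vnorm2_ge0 _) (opnorm2_ge A 0 _).
by rewrite -(scale0r 0) vnorm2Z // mul0r.
Qed.

Lemma vnorm2_mulmx {R : realType} {m n} (A : 'M[R]_(m, n)) x :
  vnorm2 (A *m x) <= opnorm2 A * vnorm2 x.
Proof.
have [x0|x0] := eqVneq (vnorm2 x) 0.
  rewrite x0 (vnorm2_eq0 x0) mulmx0 mulr0.
  by rewrite -(scale0r 0) vnorm2Z // mul0r.
have xp : 0 < vnorm2 x by rewrite lt0r x0 vnorm2_ge0.
have vi : 0 <= (vnorm2 x)^-1 by rewrite invr_ge0 ltW.
(* By homogeneity it suffices to test the normalised vector, which lies in the unit ball. *)
have := opnorm2_ge A ((vnorm2 x)^-1 *: x).
rewrite -scalemxAr !vnorm2Z // mulVf // => /(_ (lexx _)).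
by rewrite mulrC ler_pdivrMr.
Qed.

(** This is the half [|A^T| <= |A|] of the invariance of the norm under transposition: [|A^T y|^2 =
    y^T (A (A^T y)) <= |y| |A| |A^T y|], and one factor [|A^T y|] cancels. *)
Lemma vnorm2_trmx_mulmx {R : realType} {m n} (A : 'M[R]_(m, n)) y :
  vnorm2 (A^T *m y) <= opnorm2 A * vnorm2 y.
Proof.
have [->|y0] := eqVneq (vnorm2 (A^T *m y)) 0.
  by rewrite mulr_ge0 ?opnorm2_ge0 ?vnorm2_ge0.
have yp : 0 < vnorm2 (A^T *m y) by rewrite lt0r y0 vnorm2_ge0.
rewrite -(ler_pM2r yp) -expr2 sqr_vnorm2 trmx_mul trmxK -mulmxA.
apply: le_trans (dot_le_vnorm2 _ _) _.
by rewrite [leRHS]mulrAC [leRHS]mulrC ler_wpM2l ?vnorm2_ge0 ?vnorm2_mulmx.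
Qed.

Lemma opnorm2_gram {R : realType} {m n} (A : 'M[R]_(m, n)) :
  opnorm2 (A^T *m A) = opnorm2 A ^+ 2.
Proof.
apply/eqP; rewrite eq_le; apply/andP; split.
  (* Upper bound: [|A^T (A x)| <= |A| |A x| <= |A|^2] on the unit ball. *)
  apply: opnorm2_le => x x1; rewrite -mulmxA.
  apply: le_trans (vnorm2_trmx_mulmx _ _) _.
  by rewrite expr2 ler_wpM2l ?opnorm2_ge0 ?opnorm2_ge.
(* Lower bound, restated as [|A| <= sqrt |A^T A|] so that it can be checked vector by vector:
   [|A x|^2 = x^T (A^T A x) <= |A^T A|] on the unit ball. *)
rewrite -[leRHS]sqr_sqrtr ?opnorm2_ge0 //.
rewrite lerXn2r ?nnegrE ?opnorm2_ge0 ?sqrtr_ge0 //.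
apply: opnorm2_le => x x1.
rewrite -[leLHS]ger0_norm ?vnorm2_ge0 // -sqrtr_sqr ler_sqrt ?opnorm2_ge0 //.
rewrite sqr_vnorm2 trmx_mul -mulmxA [A^T *m (_ *m x)]mulmxA.
apply: le_trans (dot_le_vnorm2 _ _) _.
by rewrite -[leRHS]mul1r ler_pM ?vnorm2_ge0 ?opnorm2_ge.
Qed.

(** The columns of [D] are orthogonal to those of [V], that is [V^T D = 0]. The part subtracted from
    [U^T] in [D^T] ends in the factor [V^T], so it kills [D] and leaves [D^T D = U^T D]. *)
Lemma gram_residual {R : comUnitRingType} {m n k}
    (V : 'M[R]_(m, k)) (U : 'M[R]_(m, n)) :
  let G := invmx (V^T *m V) in
  let D := U - V *m (G *m (V^T *m U)) in
  V^T *m V \in unitmx ->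
  D^T *m D = U^T *m U - U^T *m V *m G *m (V^T *m U).
Proof.
move=> G D unitG.
have VD0 : V^T *m D = 0 by rewrite mulmxBr mulmxA mulKVmx // subrr.
have trD : D^T = U^T - (V^T *m U)^T *m G^T *m V^T.
  by rewrite [LHS]linearB /= !trmx_mul.
have -> : D^T *m D = U^T *m D.
  by rewrite {1}trD mulmxBl -[_ *m V^T *m D]mulmxA VD0 mulmx0 subr0.
by rewrite mulmxBr !mulmxA.
Qed.

Theorem theorem2 (R : realType) (m n1 n2 : nat)
    (U1 : 'M[R]_(m, n1)) (U2 : 'M[R]_(m, n2)) (eps : R) :
  let U : 'M[R]_(m, n1 + n2) := row_mx U1 U2 in
  let A : 'M[R]_(n1 + n2) := U^T *m U in
  let A11 : 'M[R]_n1 := ulsubmx A in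
  let A12 : 'M[R]_(n1, n2) := ursubmx A in
  let A21 : 'M[R]_(n2, n1) := dlsubmx A in
  A11 \in unitmx ->
  0 <= eps ->
  opnorm2 (A - col_mx A11 A21 *m invmx A11 *m row_mx A11 A12)
    <= eps * opnorm2 A ->
  exists B : 'M[R]_(n1 + n2, n1),
    opnorm2 (U - U1 *m B^T) <= Num.sqrt eps * opnorm2 U.
Proof.
move=> U A A11 A12 A21.
have eA : A = block_mx (U1^T *m U1) (U1^T *m U2) (U2^T *m U1) (U2^T *m U2).
  by rewrite /A /U tr_row_mx mul_col_row.
have e11 : A11 = U1^T *m U1 by rewrite /A11 eA block_mxKul.
(* The first block column and block row of [A] are [U^T U1] and [U1^T U], which brings the
   hypothesis to the form of [gram_residual] with [V = U1]. *)
have ecol : col_mx A11 A21 = U^T *m U1.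
  by rewrite e11 /A21 eA block_mxKdl /U tr_row_mx mul_col_mx.
have erow : row_mx A11 A12 = U1^T *m U.
  by rewrite e11 /A12 eA block_mxKur /U mul_mx_row.
rewrite ecol erow e11 => unit11 eps0.
(* The hypothesis becomes [|D|^2 <= eps |U|^2], where [D] is the residual of [U]. *)
rewrite -gram_residual // !opnorm2_gram => le_eps.
exists (invmx (U1^T *m U1) *m (U1^T *m U))^T; rewrite trmxK.
(* Both sides are nonnegative, so comparing their squares suffices. *)
rewrite -(ler_pXn2r (n := 2)) ?nnegrE ?mulr_ge0 ?opnorm2_ge0 ?sqrtr_ge0 //.
by rewrite exprMn sqr_sqrtr.
Qed.
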